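(* For any dataset $D$, any depth budget $d\ge 0$, and any parameters $\lambda>0$, $\kappa>0$, the tree returned by CLARITree has objective value at most that of the tree returned by Greedy CholeskyTree; that is, with $C_d$ and $G_d$ as defined in the context, $$C_d(D)\le G_d(D).$$
   Context: The data are $D=\{(\bm x_i,y_i)\}_{i=1}^n$, $\bm x_i\in\mathbb R^k$, $y_i\in\mathbb R$. For a (sub)dataset $D$ define the ridge leaf objective $$\mathrm{LeafObj}(D)=\min_{\beta_0\in\mathbb R,\ \boldsymbol\beta\in\mathbb R^k}\ \sum_{(\bm x_i,y_i)\in D}(y_i-\beta_0-\bm x_i^\top\boldsymbol\beta)^2+\kappa\|\boldsymbol\beta\|_2^2 .$$ Each feature $f$ has a fixed finite pool $\mathcal P_f$ of candidate thresholds. A candidate split of $D$ is a pair $(f,\tau)$ with $\tau\in\mathcal P_f$ such that $D_{f\le\tau}$ and $D_{f>\tau}$ (samples whose $f$-th coordinate is $\le\tau$, resp. $>\tau$) are both nonempty. The objective of a regression tree with ridge-linear leaves is the sum over its leaves $t$ of $\lambda+\mathrm{LeafObj}(t)$. Ties in the minimizations below are broken by a fixed deterministic rule. Greedy CholeskyTree. $G_t(D)$ denotes the objective of the tree it returns on $D$ with remaining depth $t$: $G_0(D)=\lambda+\mathrm{LeafObj}(D)$; for $t\ge 1$, if $D$ has no candidate split then $G_t(D)=\lambda+\mathrm{LeafObj}(D)$, and otherwise $$G_t(D)=\min\bigl\{\lambda+\mathrm{LeafObj}(D),\ G_{t-1}(D_{f^\circ\le\tau^\circ})+G_{t-1}(D_{f^\circ>\tau^\circ})\bigr\},$$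 where $(f^\circ,\tau^\circ)$ minimizes $\mathrm{LeafObj}(D_{f\le\tau})+\mathrm{LeafObj}(D_{f>\tau})$ over candidate splits $(f,\tau)$. CLARITree. $C_t(D)$ denotes the objective of the tree it returns on $D$ with remaining depth $t$: $C_0(D)=\lambda+\mathrm{LeafObj}(D)$; for $t\ge 1$, if $D$ has no candidate split then $C_t(D)=\lambda+\mathrm{LeafObj}(D)$, and otherwise $$C_t(D)=\min\bigl\{\lambda+\mathrm{LeafObj}(D),\ C_{t-1}(D_{f^\star\le\tau^\star})+C_{t-1}(D_{f^\star>\tau^\star})\bigr\},$$ where $(f^\star,\tau^\star)$ minimizes the greedily completed objective $G_{t-1}(D_{f\le\tau})+G_{t-1}(D_{f>\tau})$ over candidate splits $(f,\tau)$. *)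

(* Defs.v *)
From mathcomp Require Import all_boot all_order all_algebra.
From mathcomp Require Import all_classical all_reals.

Set Implicit Arguments.
Unset Strict Implicit.
Unset Printing Implicit Defensive.

Import Order.TTheory GRing.Theory Num.Theory.
Local Open Scope classical_set_scope.
Local Open Scope ring_scope.

(* A dataset is the finite family (x_i, y_i), i.e. repeated samples count
   with their multiplicity. *)
Definition dataset (R : realType) (k : nat) := seq ('cV[R]_k * R).

Definition threshold_split (R : realType) (k : nat) := ('I_k * R)%type.

Section Objective.
Variables (R : realType) (k : nat).
Implicit Types (D : dataset R k) (s : threshold_split R k).

(* The intercept b0 is not penalised.  The Euclidean norm is written out because
   the library norm on matrices is the sup norm. *)
Definition ridge_loss (kappa : R) D (b0 : R) (b : 'cV[R]_k) : R :=
  \sum_(z <- D) (z.2 - b0 - (z.1^T *m b) 0 0) ^+ 2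
  + kappa * \sum_(j < k) b j 0 ^+ 2.

(* For kappa > 0 this infimum is a minimum, see leaf_obj_min. *)
Definition leaf_obj (kappa : R) D : R :=
  inf [set ridge_loss kappa D b.1 b.2 | b in [set: R * 'cV[R]_k]].

Definition lepart D s : dataset R k :=
  [seq z : 'cV[R]_k * R <- D | z.1 s.1 0 <= s.2].
Definition gtpart D s : dataset R k :=
  [seq z : 'cV[R]_k * R <- D | s.2 < z.1 s.1 0].

Definition candidates (pool : 'I_k -> seq R) D : seq (threshold_split R k) :=
  [seq s <- [seq (f, tau) | f <- enum 'I_k, tau <- pool f]
     | (lepart D s != [::]) && (gtpart D s != [::])].

Definition minimizers (F : threshold_split R k -> R)
    (S : seq (threshold_split R k)) : seq (threshold_split R k) :=
  [seq s <- S | all (fun s' => F s <= F s') S].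

(* A deterministic tie-breaking rule: at a node with data D it selects one of
   the tied splits. *)
Definition tie_breaking
    (tie : dataset R k -> seq (threshold_split R k) -> threshold_split R k) :=
  forall D S, S != [::] -> tie D S \in S.

Section Algorithms.
Variables (lambda kappa : R) (pool : 'I_k -> seq R)
  (tie : dataset R k -> seq (threshold_split R k) -> threshold_split R k).

Definition best_split (F : threshold_split R k -> R) D : threshold_split R k :=
  tie D (minimizers F (candidates pool D)).

Definition leaf_value D : R := lambda + leaf_obj kappa D.

Fixpoint greedy_obj (t : nat) D : R :=
  if t is t'.+1 then
    if candidates pool D == [::] then leaf_value D else
    let s := best_split
      (fun s => leaf_obj kappa (lepart D s) + leaf_obj kappa (gtpart D s)) D in
    Num.min (leaf_value D)
            (greedy_obj t' (lepart D s) + greedy_obj t' (gtpart D s))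
  else leaf_value D.

Fixpoint clari_obj (t : nat) D : R :=
  if t is t'.+1 then
    if candidates pool D == [::] then leaf_value D else
    let s := best_split
      (fun s => greedy_obj t' (lepart D s) + greedy_obj t' (gtpart D s)) D in
    Num.min (leaf_value D)
            (clari_obj t' (lepart D s) + clari_obj t' (gtpart D s))
  else leaf_value D.

End Algorithms.
End Objective.

Definition sqnorm (R : realType) (m : nat) (v : 'cV[R]_m) : R :=
  \sum_i v i 0 ^+ 2.

Lemma sqnormE (R : realType) m (v : 'cV[R]_m) : sqnorm v = (v^T *m v) 0 0.
Proof. by rewrite mxE; apply: eq_bigr => i _; rewrite mxE expr2. Qed.

Lemma sqnorm_ge0 (R : realType) m (v : 'cV[R]_m) : 0 <= sqnorm v.
Proof. by apply: sumr_ge0 => i _; exact: sqr_ge0. Qed.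

Lemma sqnorm_eq0 (R : realType) m (v : 'cV[R]_m) : sqnorm v = 0 -> v = 0.
Proof.
move=> /eqP; rewrite psumr_eq0 => [/allP v0|i _]; last exact: sqr_ge0.
apply/matrixP => i j; rewrite ord1 mxE; apply/eqP.
by have := v0 i (mem_index_enum _); rewrite /= sqrf_eq0.
Qed.

Lemma normal_equations (R : realType) m p (A : 'M[R]_(m, p)) (b : 'cV[R]_m) :
  exists z : 'cV[R]_p, A^T *m (b - A *m z) = 0.
Proof.
have rkA : \rank (A^T *m A) = \rank A.
  have := mxrank_mul_ker A^T A; rewrite mxrank_tr => <-.
  suff -> : (A^T :&: kermx A)%MS = 0 by rewrite mxrank0 addn0.
  apply/eqP/rowV0P => v; rewrite sub_capmx => /andP[/submxP[u vE] /sub_kermxP vA].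
  apply: trmx_inj; rewrite trmx0; apply: sqnorm_eq0.
  by rewrite sqnormE trmxK {2}vE trmx_mul trmxK mulmxA vA mul0mx mxE.
have sA : (A <= A^T *m A)%MS.
  by have := mxrank_leqif_sup (submxMl A^T A); rewrite rkA => -[_ <-].
have /submxP[u uE] : (b^T *m A <= A^T *m A)%MS.
  exact: submx_trans (submxMl _ _) sA.
exists u^T; apply: trmx_inj; rewrite trmx_mul trmxK linearB /= trmx_mul trmxK.
by rewrite mulmxBl uE mulmxA subrr trmx0.
Qed.

Lemma least_squares (R : realType) m p (A : 'M[R]_(m, p)) (b : 'cV[R]_m) :
  exists z : 'cV[R]_p, forall w, sqnorm (b - A *m z) <= sqnorm (b - A *m w).
Proof.
have [z zE] := normal_equations A b; exists z => w.
set r := b - A *m z in zE *.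
have -> : b - A *m w = r - A *m (w - z).
  by rewrite mulmxBr opprB addrA /r subrK.
set d := A *m (w - z).
have rd : r^T *m d = 0.
  by apply: trmx_inj; rewrite trmx_mul trmxK trmx0 /d trmx_mul -mulmxA zE mulmx0.
have dr : d^T *m r = 0 by rewrite -[d^T *m r]trmxK trmx_mul trmxK rd trmx0.
clearbody d r.
rewrite [sqnorm (r - d)]sqnormE [(r - d)^T]linearB /= mulmxBl !mulmxBr rd dr.
rewrite subr0 sub0r.
by rewrite opprK mxE -!sqnormE lerDl sqnorm_ge0.
Qed.

Lemma leaf_obj_min (R : realType) k (kappa : R) (D : dataset R k) :
  0 < kappa ->
  exists b0 b, leaf_obj kappa D = ridge_loss kappa D b0 b /\
    forall c0 c, ridge_loss kappa D b0 b <= ridge_loss kappa D c0 c.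
Proof.
move=> k0.
pose n := size D; pose zi (i : 'I_n) := nth (0, 0) D i.
pose A : 'M[R]_(n + k, 1 + k) :=
  col_mx (row_mx (const_mx 1) (\matrix_(i, j) (zi i).1 j 0))
         (row_mx 0 (Num.sqrt kappa)%:M).
pose y : 'cV[R]_(n + k) := col_mx (\col_i (zi i).2) 0.
have lossE c0 c :
    ridge_loss kappa D c0 c = sqnorm (y - A *m col_mx c0%:M c).
  rewrite /y /A mul_col_mx !mul_row_col mul0mx add0r mul_scalar_mx.
  rewrite opp_col_mx add_col_mx sub0r.
  rewrite /sqnorm big_split_ord /ridge_loss; congr (_ + _).
    rewrite (big_nth (0, 0)) big_mkord; apply: eq_bigr => i _.
    rewrite col_mxEu !mxE big_ord1 !mxE /= mulr1n mul1r opprD addrA.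
    congr ((_ - _) ^+ 2).
    by apply: eq_bigr => j _; rewrite !mxE.
  rewrite mulr_sumr; apply: eq_bigr => j _.
  by rewrite col_mxEd !mxE sqrrN exprMn sqr_sqrtr ?ltW.
have [z zmin] := least_squares A y.
have zE : z = col_mx (usubmx z 0 0)%:M (dsubmx z).
  by rewrite -mx11_scalar vsubmxK.
have opt c0 c : ridge_loss kappa D (usubmx z 0 0) (dsubmx z)
                <= ridge_loss kappa D c0 c.
  by rewrite !lossE -zE.
exists (usubmx z 0 0), (dsubmx z); split=> //.
apply/eqP; rewrite eq_le; apply/andP; split.
  apply: ge_inf; first by
    exists (ridge_loss kappa D (usubmx z 0 0) (dsubmx z)) => _ [c _ <-].
  by exists (usubmx z 0 0, dsubmx z).
apply: lb_le_inf; first by exists (ridge_loss kappa D 0 0), (0, 0).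
by move=> _ [c _ <-].
Qed.

(* Main.v *)
(* At a split node CLARITree's split minimizes the greedily completed objective
   over the same candidates among which greedy picks its own split, so it
   completes greedily at no larger cost; by induction on the depth, replacing
   the greedy completions of the two parts by CLARITree's does not increase the
   cost either. *)
Require Import Defs.
From mathcomp Require Import all_boot all_order all_algebra.
From mathcomp Require Import all_classical all_reals.

Import Order.TTheory GRing.Theory Num.Theory.
Local Open Scope ring_scope.

(** A finite nonempty list attains its minimum. This is what makes [tie_breaking] applicable, since
    it constrains [tie] on nonempty lists only. *)
Lemma minimizers_neq0 (R : realType) (k : nat)
    (F : threshold_split R k -> R) (S : seq (threshold_split R k)) :
  S != [::] -> minimizers F S != [::].
Proof.
move=> S0; suff [s sS smin] : exists2 s, s \in S & all (fun s' => F s <= F s') S.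
  by rewrite -has_filter; apply/hasP; exists s.
elim: S S0 => // a S IH _.
have [->|/IH[s sS smin]] := eqVneq S [::].
  by exists a; rewrite ?mem_head //= lexx.
case: (leP (F a) (F s)) => [as_le|sa_lt].
  exists a; first exact: mem_head.
  by rewrite /= lexx; apply: sub_all smin => s'; exact: le_trans.
exists s; first by rewrite inE sS orbT.
by rewrite /= ltW.
Qed.

Lemma best_splitP (R : realType) (k : nat) (pool : 'I_k -> seq R)
    (tie : dataset R k -> seq (threshold_split R k) -> threshold_split R k)
    (F : threshold_split R k -> R) (D : dataset R k) :
  tie_breaking tie -> candidates pool D != [::] ->
  best_split pool tie F D \in candidates pool D /\
  {in candidates pool D, forall s, F (best_split pool tie F D) <= F s}.
Proof.
move=> tieP cand0; have := tieP D _ (minimizers_neq0 _ _ F _ cand0).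
by rewrite mem_filter => /andP[/allP].
Qed.

Theorem theorem5p3 (R : realType) (k : nat) (lambda kappa : R)
    (pool : 'I_k -> seq R)
    (tie : dataset R k -> seq (threshold_split R k) -> threshold_split R k)
    (D : dataset R k) (d : nat) :
  0 < lambda -> 0 < kappa -> tie_breaking tie ->
  clari_obj lambda kappa pool tie d D <= greedy_obj lambda kappa pool tie d D.
Proof.
move=> _ _ tieP; elim: d D => [//|d IH] D /=.
case: ifPn => // cand0; apply: le_min2 => //.
set G := fun s => greedy_obj _ _ _ _ d (lepart D s) + _.
set F := fun s => leaf_obj _ (lepart D s) + _.
have [_ Gmin] := best_splitP _ _ _ _ G _ tieP cand0.
(* Greedy's split enters only as a candidate, which makes it a competitor in the minimization of
   [G]. *)
have [Fcand _] := best_splitP _ _ _ _ F _ tieP cand0.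
(* The middle term is [G] at CLARITree's split; [IH] bounds each part there. *)
by apply: le_trans (Gmin _ Fcand); apply: lerD.
Qed.
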